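(* Let $d$ be a non-negative integer. Then there exist polynomials $F_{1,d}(x),G_{1,d}(x),H_{1,d}(x)$ with real coefficients satisfying $$2\sum_{k=1}^{n}k^ds_{k-1}=F_{1,d}(n)s_{n+1}+G_{1,d}(n)s_n+H_{1,d}(n)\qquad\text{for all } n\in\mathbb N.$$
   Context: $\mathbb N$ denotes the positive integers. Fix $a,b\in\mathbb N$ and $c_0,c_1\in\mathbb Z$ with $(c_0,c_1)\neq(0,0)$. The generalized Fibonacci sequence $(s_n)_{n\ge0}$ is defined by $s_0=c_0$, $s_1=c_1$, and $s_{n+1}=as_n+bs_{n-1}$ for all $n\in\mathbb N$. *)

(* Defs.v *)
From mathcomp Require Import all_boot all_order all_algebra.

Set Implicit Arguments.
Unset Strict Implicit.
Unset Printing Implicit Defensive.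

Import GRing.Theory.
Local Open Scope ring_scope.

Fixpoint genfib (a b : nat) (c0 c1 : int) (n : nat) : int :=
  match n with
  | 0%N => c0
  | n1.+1 =>
      match n1 with
      | 0%N => c1
      | n2.+1 => a%:Z * genfib a b c0 c1 n1 + b%:Z * genfib a b c0 c1 n2
      end
  end.

(* Main.v *)
(* Summation by parts turns the claim into the difference equation
   b F(n+2) + a F(n+1) - F(n) = 2 (n+2)^d.  Writing E for the shift, the operator
   b E^2 + a E - 1 equals (a + b - 1) plus a degree-lowering operator, so it is
   onto polynomials because a + b - 1 <> 0; then G(n) = b F(n+1) - 2 (n+1)^d,
   and H can be taken constant. *)

Require Import Defs.
From mathcomp Require Import all_boot all_order all_algebra.
From mathcomp Require Import reals ring.

Set Implicit Arguments.
Unset Strict Implicit.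
Unset Printing Implicit Defensive.

Import Order.TTheory GRing.Theory Num.Theory.
Local Open Scope ring_scope.

(** A shift keeps both size and leading coefficient, so the top terms cancel. *)
Lemma size_shift_sub (R : idomainType) (p : {poly R}) (c : R) :
  p != 0 -> (size (p \Po ('X + c%:P) - p)%R < size p)%N.
Proof.
move=> p_neq0; have p_gt0 : (0 < size p)%N by rewrite size_poly_gt0.
have sizeE : size (p \Po ('X + c%:P)) = size p.
  by rewrite size_comp_poly2 // size_XaddC.
have leadE : lead_coef (p \Po ('X + c%:P)) = lead_coef p.
  by rewrite lead_coef_comp ?size_XaddC // lead_coefXaddC expr1n mulr1.
rewrite -(prednK p_gt0) ltnS; apply/leq_sizeP => j.
rewrite leq_eqVlt => /orP[/eqP <-|lt_j]; rewrite coefB.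
  by move: leadE; rewrite !lead_coefE sizeE => ->; rewrite subrr.
by rewrite prednK // in lt_j; rewrite !nth_default ?sizeE // subrr.
Qed.

(** Induction on a bound for the size of [p]: up to the factor [u + v + w], the operator fixes [p]
    modulo polynomials of smaller size. *)
Lemma shift_recurrence_onto (F : fieldType) (u v w x y : F) (p : {poly F}) :
  u + v + w != 0 ->
  exists q : {poly F},
    u *: (q \Po ('X + x%:P)) + v *: (q \Po ('X + y%:P)) + w *: q = p.
Proof.
move=> k_neq0; move: {2}(size p) (leqnn (size p)) => m.
elim: m p => [|m IHm] p sz_p.
  exists 0; move: sz_p; rewrite leqn0 size_poly_eq0 => /eqP->.
  by rewrite !comp_poly0 !scaler0 !addr0.
have [->|p_neq0] := eqVneq p 0.
  by exists 0; rewrite !comp_poly0 !scaler0 !addr0.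
pose D c := p \Po ('X + c%:P) - p.
have szD c : (size (D c) <= m)%N.
  by rewrite -ltnS (leq_trans _ sz_p) // size_shift_sub.
pose k := (u + v + w)^-1.
(* The operator sends [k *: p] to [p + (k * u) *: D x + (k * v) *: D y]; [q] is chosen to cancel the
   last two terms. *)
have [|q qE] := IHm (- (k * u) *: D x - (k * v) *: D y).
  rewrite (leq_trans (size_polyD _ _)) // size_polyN geq_max.
  by rewrite !(leq_trans (size_scale_leq _ _)).
exists (k *: p + q); rewrite !comp_polyD !comp_polyZ !scalerDr.
have kE : k%:P * (u%:P + v%:P + w%:P) = 1.
  by rewrite -!polyCD -polyCM mulVf.
move: qE; rewrite /D -!mul_polyC !(polyCN, polyCM).
set p1 := p \Po _; set p2 := p \Po _; set q1 := q \Po _; set q2 := q \Po _.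
move=> qE; transitivity (k%:P * (u%:P * p1 + v%:P * p2 + w%:P * p)
  + (u%:P * q1 + v%:P * q2 + w%:P * q)); first by ring.
rewrite qE; transitivity (k%:P * (u%:P + v%:P + w%:P) * p); first by ring.
by rewrite kE mul1r.
Qed.

Theorem lemma2p4 (R : realType) (a b : nat) (c0 c1 : int)
    (a_gt0 : (0 < a)%N) (b_gt0 : (0 < b)%N)
    (c_neq0 : (c0, c1) <> (0, 0)) (d : nat) :
  exists F G H : {poly R}, forall n : nat, (0 < n)%N ->
    2 * \sum_(1 <= k < n.+1) k%:R ^+ d * (genfib a b c0 c1 k.-1)%:~R
    = F.[n%:R] * (genfib a b c0 c1 n.+1)%:~R
      + G.[n%:R] * (genfib a b c0 c1 n)%:~R + H.[n%:R].
Proof.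
have ab_neq0 : b%:R + a%:R - 1 != 0 :> R.
  rewrite subr_eq0 -natrD pnatr_eq1; case: a b a_gt0 b_gt0 => [|a'] [|b'] //.
  by rewrite addnS addSn.
have [F FE] := shift_recurrence_onto 2 1%:R (2 *: ('X + 2%:P) ^+ d) ab_neq0.
(* This choice makes the coefficients of [s n] agree in the increment from [n] to [n.+1]. *)
pose G : {poly R} := b%:R *: (F \Po ('X + 1%:P)) - 2 *: ('X + 1%:P) ^+ d.
pose s n : R := (genfib a b c0 c1 n)%:~R.
have sS n : s n.+2 = a%:R * s n.+1 + b%:R * s n.
  by rewrite /s [genfib _ _ _ _ n.+2]/= rmorphD !rmorphM.
(* The constant makes the identity true at 0, where the sum is empty, so the induction can start
   there. *)
exists F, G, (- (F.[0] * s 1%N + G.[0] * s 0%N))%:P => n _.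
rewrite hornerC -!/(s _).
elim: n => [|n IHn]; first by rewrite big_geq // mulr0 subrr.
rewrite big_nat_recr //= mulrDr {}IHn -/(s n) sS.
(* What remains is the coefficient of [s n.+1], namely [a F(n+1) + G(n+1) - F(n)]; it vanishes by
   the difference equation at [n]. *)
have := congr1 (horner^~ n%:R) FE.
have -> : G.[n%:R] = b%:R * F.[n.+1%:R] - 2 * n.+1%:R ^+ d.
  by rewrite /G !hornerE horner_comp !hornerE natr1.
have -> : G.[n.+1%:R] = b%:R * F.[n.+2%:R] - 2 * n.+2%:R ^+ d.
  by rewrite /G !hornerE horner_comp !hornerE natr1.
have XDE j : ('X + j%:R%:P).[n%:R] = (n + j)%:R :> R.
  by rewrite hornerD hornerX hornerC natrD.
rewrite !hornerD !hornerZ !horner_comp horner_exp !XDE addn2 addn1 => FnE.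
have {}FnE : F.[n%:R] = b%:R * F.[n.+2%:R] + a%:R * F.[n.+1%:R] - 2 * n.+2%:R ^+ d.
  by rewrite -FnE; ring.
rewrite FnE; ring.
Qed.
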